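(* Let $c$ be a $0$-convex path in $\mathbb{R}^2$ and let $\alpha : I\rightarrow \mathbb{R}^{2}$ be a parametrization of $c$. For each $t\in I$, let $E(t)$ be the ellipse centered at the origin osculating $\alpha$ at $t$. Then the curve $E:I\rightarrow \mathcal{E}$ is light-like, that is, $\left\Vert E'(t)\right\Vert =0$ for all $t\in I$. If $\alpha$ is moreover a standard centro-affine parametrization of $c$ and $\varkappa :I\rightarrow \mathbb{R}$ is the centro-affine curvature of $\alpha$, then $$\varkappa^{2}(t)=\left\Vert \frac{D}{dt}E'(t)\right\Vert$$ for all $t\in I$. Moreover, $\varkappa$ is positive or negative depending on whether $E$ is future or past directed; that is, for $t\in I$, $\varkappa(t)>0$ if and only if $E'(t)$ is future directed, and $\varkappa(t)<0$ if and only if $E'(t)$ is past directed.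
   Context: Conventions on curves. Smooth means of class $C^3$; curves, parametrizations and reparametrizations are smooth. For $u,v\in\mathbb{R}^2$ write $u\wedge v=\det(u,v)$. A path in the plane is an oriented embedded submanifold $c\subset\mathbb{R}^2$ diffeomorphic to $\mathbb{R}$. A parametrization of $c$ is an embedding $\alpha:I\to\mathbb{R}^2$ of an open interval $I$ with image $c$ such that $\alpha'$ is positive with respect to the orientation of $c$. A curve $\alpha:I\to\mathbb{R}^2$ is $0$-convex if $\alpha\wedge\alpha'$ and $\alpha'\wedge\alpha''$ are both positive functions. A path is $0$-convex if some (equivalently, any) of its parametrizations is $0$-convex. Standard centro-affine parametrization. A parametrization $\alpha:I\to\mathbb{R}^2$ of a $0$-convex path is called a standard centro-affine parametrization if $\alpha''=-\alpha+\tfrac12\varkappa\,\alpha'$ for some smooth function $\varkappa:I\to\mathbb{R}$; this $\varkappa$ is the centro-affine curvature of $\alpha$. Osculating ellipses. All ellipses are centered at $0$ (axes not necessarily parallel to the coordinate axes). The Euclidean curvature of a regular plane curve $\alpha$ is $\kappa_\alpha=(\alpha'\wedge\alpha'')/|\alpha'|^3$. The ellipse centered at $0$ osculating a $0$-convex curve $\alpha$ at $t_0$ is the (unique) ellipse $E$ centered at $0$ having a counterclockwise parametrization $\varepsilon$ with $\varepsilon(0)=\alpha(t_0)$, $\varepsilon'(0)$ a multiple of $\alpha'(t_0)$, and $\kappa_\varepsilon(0)=\kappa_\alpha(t_0)$. Lorentz metric on the space of ellipses. Let $\mathcal{E}$ be the set of all ellipses in $\mathbb{R}^2$ centered at $0$,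 $\mathcal{S}$ the vector space of real symmetric $2\times2$ matrices, and $\mathcal{S}_+\subset\mathcal{S}$ the open subset of positive definite ones. Identify $\mathcal{S}_+$ with $\mathcal{E}$ by the bijection $A\mapsto E_A=\{z\in\mathbb{R}^2\mid\langle A^{-1}z,z\rangle=1\}=A^{1/2}S^1$. The group $G=GL_+(2,\mathbb{R})$ acts by $g\cdot A=gAg^T$ on $\mathcal{S}_+$ and by $g\cdot E=g(E)$ on $\mathcal{E}$, and the bijection is equivariant. Endow $\mathcal{S}_+$ with the $G$-invariant Lorentz metric given by $\langle X,X\rangle=\|X\|:=-\det(A^{-1}X)$ for $X\in T_A\mathcal{S}_+\cong\mathcal{S}$ (so $\|\cdot\|$ denotes the quadratic form of the metric, not its square root), and endow $\mathcal{E}$ with the manifold structure and the Lorentz metric transported by this bijection. $\frac{D}{dt}$ denotes the covariant derivative along a curve for the Levi-Civita connection of this metric. Temporal orientation. The future cone in $T_I\mathcal{S}_+\cong\mathcal{S}$ consists of all $X\in\mathcal{S}$ with $\|X\|\le0$ such that $X_{11}>0$ or $X_{22}>0$. It is extended to all of $\mathcal{S}_+$ by the $G$-action (at $A=gg^T$ with $g\in G$, $X$ is future directed iff $g^{-1}X(g^{-1})^T$ is in the future cone at $I$), and transported to $\mathcal{E}$. A vector $X$ is past directed if $-X$ is future directed. *)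

(* Defs.v *)
From HB Require Import structures.
From mathcomp Require Import all_boot all_order all_algebra.
From mathcomp Require Import all_classical all_reals all_analysis.

Set Implicit Arguments.
Unset Strict Implicit.
Unset Printing Implicit Defensive.

Import Order.TTheory GRing.Theory Num.Theory.
Import numFieldNormedType.Exports.

Local Open Scope ring_scope.
Local Open Scope classical_set_scope.

(** Plane vectors are column vectors ['cV[R]_2].  The norm that MathComp-Analysis
    puts on them is the sup norm; it is used only for its topology, and lengths
    are measured by [enorm].  A curve on an interval [I] is a function on all of
    [R] of which only the restriction to the open set [I] matters. *)

Section Plane.
Variable R : realType.
Implicit Types u v : 'cV[R]_2.

Definition wedge u v : R := \det (row_mx u v : 'M[R]_2).

Definition dot u v : R := (u^T *m v) 0 0.

Definition enorm u : R := Num.sqrt (dot u u).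

End Plane.

Section Curves.
Variable R : realType.

Definition class_C (V : normedModType R) (k : nat) (I : set R) (f : R -> V) :=
  (forall i : nat, (i < k)%N -> forall t, I t -> derivable (derive1n i f) t 1) /\
  (forall t, I t -> {for t, continuous (derive1n k f)}).

Definition smooth (V : normedModType R) (I : set R) (f : R -> V) :=
  class_C 3 I f.

Definition open_interval (I : set R) := [/\ I !=set0, open I & is_interval I].

Definition embedding (I : set R) (alpha : R -> 'cV[R]_2) :=
  [/\ smooth I alpha,
      (forall t, I t -> derive1 alpha t != 0) &
      exists g : 'cV[R]_2 -> R,
        (forall t, I t -> g (alpha t) = t) /\
        {within alpha @` I, continuous g}].

(** An embedded submanifold diffeomorphic to [R] is the image of an embedding of
    [R].  The orientation is recorded by the open half-line of positive tangent
    vectors at each point of the path; that these are the positive multiples of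
    the velocity of one embedding expresses that the orientation is continuous. *)
Record oriented_path := OrientedPath {
  path_set :> set 'cV[R]_2 ;
  path_pos : 'cV[R]_2 -> set 'cV[R]_2 ;
  oriented_pathP : exists gamma : R -> 'cV[R]_2,
    [/\ embedding setT gamma,
        range gamma = path_set &
        forall s, path_pos (gamma s) =
                  [set a *: derive1 gamma s | a in [set a : R | 0 < a]]]
}.

Definition parametrization (c : oriented_path) (I : set R)
    (alpha : R -> 'cV[R]_2) :=
  [/\ open_interval I,
      embedding I alpha,
      alpha @` I = path_set c &
      forall t, I t -> path_pos c (alpha t) (derive1 alpha t)].

Definition zero_convex_curve (I : set R) (alpha : R -> 'cV[R]_2) :=
  forall t, I t -> 0 < wedge (alpha t) (derive1 alpha t) /\
                   0 < wedge (derive1 alpha t) (derive1n 2 alpha t).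

Definition zero_convex_path (c : oriented_path) :=
  exists I alpha, parametrization c I alpha /\ zero_convex_curve I alpha.

Definition centro_affine_curvature (I : set R) (alpha : R -> 'cV[R]_2)
    (kappa : R -> R) :=
  smooth I (kappa : R -> R^o) /\
  forall t, I t ->
    derive1n 2 alpha t = - alpha t + (2^-1 * kappa t) *: derive1 alpha t.

Definition euclidean_curvature (alpha : R -> 'cV[R]_2) (t : R) : R :=
  wedge (derive1 alpha t) (derive1n 2 alpha t) / enorm (derive1 alpha t) ^+ 3.

End Curves.

Section Ellipses.
Variable R : realType.

Definition sym (X : 'M[R]_2) := X^T = X.

Definition sym_pos (A : 'M[R]_2) :=
  sym A /\ forall z : 'cV[R]_2, z != 0 -> 0 < dot (A *m z) z.

Definition ellipse (A : 'M[R]_2) : set 'cV[R]_2 :=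
  [set z | dot (invmx A *m z) z = 1].

Definition is_ellipse (E : set 'cV[R]_2) :=
  exists A, sym_pos A /\ E = ellipse A.

(** The inverse of the bijection [A |-> ellipse A] from positive definite
    symmetric matrices to ellipses: a global chart of the space of ellipses, in
    which velocities, the metric and the time orientation are read. *)
Definition ellipse_mx (E : set 'cV[R]_2) : 'M[R]_2 :=
  get [set A | sym_pos A /\ E = ellipse A].

(** For an ellipse centered at the origin, a regular parametrization [eps] is
    counterclockwise iff [wedge eps eps'] is positive. *)
Definition ccw_ellipse_param (E : set 'cV[R]_2) (eps : R -> 'cV[R]_2) :=
  [/\ smooth setT eps,
      range eps = E &
      forall s, 0 < wedge (eps s) (derive1 eps s)].

Definition osculates (alpha : R -> 'cV[R]_2) (t0 : R) (E : set 'cV[R]_2) :=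
  is_ellipse E /\
  exists eps : R -> 'cV[R]_2,
    [/\ ccw_ellipse_param E eps,
        eps 0 = alpha t0,
        exists m : R, derive1 eps 0 = m *: derive1 alpha t0 &
        euclidean_curvature eps 0 = euclidean_curvature alpha t0].

Definition osculating_ellipse (alpha : R -> 'cV[R]_2) (t0 : R) :
    set 'cV[R]_2 :=
  get (osculates alpha t0).

End Ellipses.

Section Lorentz.
Variable R : realType.
Implicit Types A X Y Z : 'M[R]_2.

(** The quadratic form of the metric at [A], for [X] symmetric. *)
Definition lorentz_form A X : R := - \det (invmx A *m X).

Definition lorentz_metric A X Y : R :=
  2^-1 * (lorentz_form A (X + Y) - lorentz_form A X - lorentz_form A Y).

(** An affine connection on the open subset of positive definite matrices of the
    vector space of symmetric matrices is [nabla_X Y = D_X Y + Gamma(X, Y)], with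
    [Gamma A] bilinear on symmetric matrices.  Its torsion vanishes iff [Gamma A]
    is symmetric, and by the Leibniz rule compatibility with the metric need only
    be tested on constant vector fields [X], [Y]. *)
Definition is_levi_civita (Gamma : 'M[R]_2 -> 'M[R]_2 -> 'M[R]_2 -> 'M[R]_2) :=
  forall A, sym_pos A ->
  [/\ (forall X Y, sym X -> sym Y -> sym (Gamma A X Y)),
      (forall (a : R) X Y Z, sym X -> sym Y -> sym Z ->
         Gamma A (a *: X + Y) Z = a *: Gamma A X Z + Gamma A Y Z),
      (forall X Y, sym X -> sym Y -> Gamma A X Y = Gamma A Y X) &
      (forall X Y Z, sym X -> sym Y -> sym Z ->
         is_derive A Z ((fun B => lorentz_metric B X Y) : 'M[R]_2 -> R^o)
           (lorentz_metric A (Gamma A Z X) Y +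
            lorentz_metric A X (Gamma A Z Y)))].

(** The choice is immaterial: these conditions determine [Gamma A X Y] for [A]
    positive definite and [X], [Y] symmetric. *)
Definition levi_civita : 'M[R]_2 -> 'M[R]_2 -> 'M[R]_2 -> 'M[R]_2 :=
  get is_levi_civita.

(** The covariant derivative [D/dt] of a vector field [V] along a curve [A] of
    positive definite symmetric matrices. *)
Definition covariant_derivative (A V : R -> 'M[R]_2) (t : R) : 'M[R]_2 :=
  derive1 V t + levi_civita (A t) (derive1 A t) (V t).

Definition future_cone1 X :=
  [/\ sym X, lorentz_form 1%:M X <= 0 & 0 < X 0 0 \/ 0 < X 1 1].

Definition future_directed A X :=
  exists g : 'M[R]_2,
    [/\ 0 < \det g, A = g *m g^T &
        future_cone1 (invmx g *m X *m (invmx g)^T)].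

Definition past_directed A X := future_directed A (- X).

End Lorentz.

(* Main.v *)
Require Import Defs.
From HB Require Import structures.
From mathcomp Require Import all_boot all_order all_algebra.
From mathcomp Require Import all_classical all_reals all_analysis.
From mathcomp Require Import ring lra.
Import Order.TTheory GRing.Theory Num.Theory.
Import numFieldNormedType.Exports.
Local Open Scope ring_scope.
Local Open Scope classical_set_scope.
Set Implicit Arguments.
Unset Strict Implicit.
Unset Printing Implicit Defensive.

(** Let [u], [v], [a] be the position, velocity and acceleration of a zero-convex
    curve.  In the chart given by positive definite matrices, its osculating
    ellipse is [A = u u^T + (u ^ v / v ^ a) v v^T], where [^] is the wedge.  Indeed
    the ellipse with conjugate radii [u] and [m v] has this matrix for
    [m ^ 2 = u ^ v / v ^ a], which is what the curvature condition requires
    ([osculates_osculating_mx]); conversely, differentiating the equation of an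
    osculating ellipse twice gives its quadratic form on the basis [u], [v]
    ([osculates_unique]).

    When [A] is differentiated, the terms in [u v^T + v u^T] cancel, because the
    component of [a] along [u] is [- (v ^ a) / (u ^ v)].  So [A'] is a multiple of
    the rank one matrix [v v^T] ([is_derive_osculating_mx]); its determinant
    vanishes, and the curve is light-like.

    If [a = - u + (k / 2) v], then [v ^ a = u ^ v], so [A = u u^T + v v^T] and
    [A' = k v v^T], whose time direction is the sign of [k]
    ([future_directed_outer]).  The quadratic form of the metric at [A] is
    [- \det X / \det A], so that the metric is conformally flat, and on a null
    vector [V] its connection is
    [- (det_polar A V / \det A) V] ([levi_civita_null]).  Here this equals
    [- k ^ 2 v v^T], and the covariant acceleration is
    [k' v v^T - k (u v^T + v u^T)], of determinant [- k ^ 2 (u ^ v) ^ 2], while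
    [\det A = (u ^ v) ^ 2] ([lorentz_form_acceleration]).

    The zero-convexity assumed of some parametrization of the path is transferred
    to the given one by showing that the change of parameter, a priori only
    continuous, is differentiable ([parametrization_zero_convex]). *)

(** * Plane linear algebra in coordinates *)

Lemma sum_ord2 (V : nmodType) (F : 'I_2 -> V) : \sum_(i < 2) F i = F 0 + F 1.
Proof.
rewrite big_ord_recl big_ord1; congr (_ + F _).
exact: val_inj.
Qed.

Lemma eq_ord2 (P : 'I_2 -> Prop) : P 0 -> P 1 -> forall i, P i.
Proof.
move=> P0 P1; case=> [[|[|//]]] lti.
- by rewrite (_ : Ordinal lti = 0) //; exact: val_inj.
- by rewrite (_ : Ordinal lti = 1) //; exact: val_inj.
Qed.

Section PlaneAlgebra.
Context {R : realType}.
Implicit Types (u v w : 'cV[R]_2) (A B X Y Z P : 'M[R]_2).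

Lemma eq_cV2 u v : u 0 0 = v 0 0 -> u 1 0 = v 1 0 -> u = v.
Proof.
move=> e0 e1; apply/matrixP => i j; rewrite ord1.
by move: i; apply: eq_ord2.
Qed.

Lemma eq_mx2 X Y : X 0 0 = Y 0 0 -> X 0 1 = Y 0 1 ->
  X 1 0 = Y 1 0 -> X 1 1 = Y 1 1 -> X = Y.
Proof.
by move=> *; apply/matrixP; apply: eq_ord2; apply: eq_ord2.
Qed.

Lemma mulmx2E m n (X : 'M[R]_(m, 2)) (Y : 'M[R]_(2, n)) i j :
  (X *m Y) i j = X i 0 * Y 0 j + X i 1 * Y 1 j.
Proof. by rewrite mxE sum_ord2. Qed.

Lemma outerE u v i j : (u *m v^T) i j = u i 0 * v j 0.
Proof. by rewrite mxE big_ord1 mxE. Qed.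

Lemma det_mx22 X : \det X = X 0 0 * X 1 1 - X 0 1 * X 1 0.
Proof.
rewrite (expand_det_row _ 0) sum_ord2 /cofactor !det_mx11 !mxE /=.
rewrite (_ : lift 0 0 = 1); last exact: val_inj.
rewrite (_ : lift 1 0 = 0); last exact: val_inj.
by rewrite expr0 mul1r expr1 mulN1r mulrN.
Qed.

Lemma row_mx2_0 u v i : row_mx u v i (0 : 'I_2) = u i 0.
Proof.
rewrite (_ : (0 : 'I_2) = lshift 1 (0 : 'I_1)); last exact: val_inj.
by rewrite row_mxEl.
Qed.

Lemma row_mx2_1 u v i : row_mx u v i (1 : 'I_2) = v i 0.
Proof.
rewrite (_ : (1 : 'I_2) = rshift 1 (0 : 'I_1)); last exact: val_inj.
by rewrite row_mxEr.
Qed.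

Lemma wedgeE u v : wedge u v = u 0 0 * v 1 0 - v 0 0 * u 1 0.
Proof. by rewrite /wedge det_mx22 !row_mx2_0 !row_mx2_1. Qed.

Lemma dotE u v : dot u v = u 0 0 * v 0 0 + u 1 0 * v 1 0.
Proof. by rewrite /dot mulmx2E !mxE. Qed.

Lemma dotDr (x y z : 'cV[R]_2) : dot x (y + z) = dot x y + dot x z.
Proof. by rewrite !dotE !mxE; ring. Qed.

Lemma dotZl (k : R) (x y : 'cV[R]_2) : dot (k *: x) y = k * dot x y.
Proof. by rewrite !dotE !mxE; ring. Qed.

Lemma dotZr (k : R) (x y : 'cV[R]_2) : dot x (k *: y) = k * dot x y.
Proof. by rewrite !dotE !mxE; ring. Qed.

Lemma dot_gt0 v : v != 0 -> 0 < dot v v.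
Proof.
move=> v0; rewrite dotE -!expr2 lt0r addr_ge0 ?sqr_ge0// andbT.
apply: contra_neq v0; move/eqP; rewrite paddr_eq0 ?sqr_ge0// !sqrf_eq0.
by move=> /andP[/eqP e0 /eqP e1]; apply: eq_cV2; rewrite ?e0 ?e1 mxE.
Qed.

Lemma wedgevv u : wedge u u = 0.
Proof. by rewrite wedgeE subrr. Qed.

Lemma wedgeZl (a : R) u v : wedge (a *: u) v = a * wedge u v.
Proof. by rewrite !wedgeE !mxE; ring. Qed.

Lemma wedgeZr (a : R) u v : wedge u (a *: v) = a * wedge u v.
Proof. by rewrite !wedgeE !mxE; ring. Qed.

Lemma wedge_antisym (u v : 'cV[R]_2) : wedge u v = - wedge v u.
Proof. by rewrite !wedgeE; ring. Qed.

Lemma wedge_rot u v : wedge v (- u) = wedge u v.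
Proof. by rewrite !wedgeE !mxE; ring. Qed.

Lemma wedge_neq0r u v : wedge u v != 0 -> v != 0.
Proof. by apply: contraNneq => ->; rewrite wedgeE !mxE !(mulr0, mul0r) subrr. Qed.

(** Cramer's rule in the basis [u], [v]. *)
Lemma wedge_decomp u v w : wedge u v != 0 ->
  w = (wedge w v / wedge u v) *: u + (wedge u w / wedge u v) *: v.
Proof.
rewrite !wedgeE => d0; apply: eq_cV2; rewrite !mxE; field; exact: d0.
Qed.

(** The symmetric bilinear form with [det_polar X X = 2 * \det X]. *)
Definition det_polar X Y : R :=
  X 0 0 * Y 1 1 + X 1 1 * Y 0 0 - X 0 1 * Y 1 0 - X 1 0 * Y 0 1.

Lemma sym_entry X : sym X -> X 1 0 = X 0 1.
Proof. by move=> sX; rewrite -[in LHS]sX mxE. Qed.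

Lemma sym_dotC (C : 'M[R]_2) x y : sym C -> dot (C *m x) y = dot (C *m y) x.
Proof. by move=> sC; rewrite !dotE !mulmx2E (sym_entry sC); ring. Qed.

Lemma det_polar_inj X Y : sym X -> sym Y ->
  (forall Z, sym Z -> det_polar X Z = det_polar Y Z) -> X = Y.
Proof.
move=> /sym_entry sX /sym_entry sY e.
pose Zm (a b d : R) : 'M[R]_2 :=
  \matrix_(i, j) if i == j then (if i == 0 then a else d) else b.
have sZ a b d : sym (Zm a b d).
  by apply/matrixP => i j; rewrite !mxE eq_sym; case: eqP => // ->.
have := e _ (sZ 1 0 0); have := e _ (sZ 0 1 0); have := e _ (sZ 0 0 1).
rewrite /det_polar !mxE /= => e1 e2 e3.
apply: eq_mx2; lra.
Qed.

Lemma lorentz_formE A X : lorentz_form A X = - (\det X / \det A).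
Proof. by rewrite /lorentz_form det_mulmx det_inv mulrC. Qed.

Lemma lorentz_metricE A X Y :
  lorentz_metric A X Y = - (2^-1 * det_polar X Y) * (\det A)^-1.
Proof.
rewrite /lorentz_metric !lorentz_formE !det_mx22 /det_polar !mxE.
ring.
Qed.

Lemma sym_pos_det_gt0 A : sym_pos A -> 0 < \det A.
Proof.
move=> [/sym_entry sA posA]; rewrite det_mx22 sA.
have A00 : 0 < A 0 0.
  have := posA (\col_i (i == 0)%:R).
  rewrite dotE !mulmx2E !mxE /= !(mulr0, mulr1, addr0); apply.
  by apply/eqP => /matrixP /(_ 0 0); rewrite !mxE /=; apply/eqP; rewrite oner_eq0.
(* [A] maps this vector to a multiple of a basis vector *)
have := posA (\col_i if i == 0 then - A 0 1 else A 0 0).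
rewrite dotE !mulmx2E !mxE /= sA => /(_ _)/wrap[].
  by apply/eqP => /matrixP /(_ 1 0); rewrite !mxE /=; apply/eqP; rewrite gt_eqF.
rewrite (_ : _ + _ = (A 0 0 * A 1 1 - A 0 1 * A 0 1) * A 0 0); last by ring.
by rewrite pmulr_lgt0.
Qed.

Lemma sym_pos_gram P : P \in unitmx -> sym_pos (P *m P^T).
Proof.
move=> uP; split=> [|z z0]; first by rewrite /sym trmx_mul trmxK.
rewrite /dot trmx_mul trmx_mul trmxK.
have y0 : P^T *m z != 0.
  apply: contra_neq z0 => e; rewrite -[z](mulKmx (_ : P^T \in unitmx)) ?unitmx_tr//.
  by rewrite e mulmx0.
rewrite (_ : _ *m z = (P^T *m z)^T *m (P^T *m z)); first exact: dot_gt0.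
by rewrite trmx_mul trmxK !mulmxA.
Qed.

(** The ellipse of [P *m P^T] is the image of the unit circle under [P]. *)
Lemma ellipse_gram P : P \in unitmx ->
  ellipse (P *m P^T) = [set P *m p | p in [set p | dot p p = 1]].
Proof.
move=> uP; have uT : P^T \in unitmx by rewrite unitmx_tr.
have uA : P *m P^T \in unitmx by rewrite unitmx_mul uP.
have E p : dot (invmx (P *m P^T) *m (P *m p)) (P *m p) = dot p p.
  have -> : invmx (P *m P^T) *m (P *m p) = invmx P^T *m p.
    rewrite mulmxA; congr (_ *m p).
    by rewrite -[LHS](mulmxK uT) -[_ *m P *m _]mulmxA mulVmx// mul1mx.
  by rewrite /dot trmx_mul trmx_inv trmxK mulmxA mulmxKV.
apply/seteqP; split=> z /=.
- move=> zE; exists (invmx P *m z); last by rewrite mulKVmx.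
  by rewrite -E mulKVmx.
- by move=> [p p1 <-]; rewrite /ellipse/= E.
Qed.

Lemma circle_param p : dot p p = 1 ->
  exists s : R, p 0 0 = cos s /\ p 1 0 = sin s.
Proof.
rewrite dotE -!expr2 => p1.
have y2 : 1 - p 0 0 ^+ 2 = p 1 0 ^+ 2 by rewrite -p1; ring.
have b : -1 <= p 0 0 <= 1.
  rewrite -ler_norml -(@ler_sqr _ `|_|) ?nnegrE// real_normK ?num_real//.
  by rewrite expr1n -p1 lerDl sqr_ge0.
have [y0|y0] := leP 0 (p 1 0).
- exists (acos (p 0 0)); rewrite acosK ?in_itv//= sin_acos// y2 sqrtr_sqr.
  by rewrite ger0_norm.
- exists (- acos (p 0 0)); rewrite cosN sinN acosK ?in_itv//= sin_acos// y2.
  by rewrite sqrtr_sqr ltr0_norm// opprK.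
Qed.

End PlaneAlgebra.

(** * Derivatives of vector-valued and matrix-valued functions *)

Section Calculus.
Context {R : realType}.

Lemma is_derive_mx (V : normedModType R) m n (M : V -> 'M[R]_(m, n)) t v
    (M' : 'M[R]_(m, n)) :
  (forall i j, is_derive t v (fun x => M x i j : R) (M' i j)) ->
  is_derive t v M M'.
Proof.
move=> H; have dM : derivable M t v.
  by apply/derivable_mxP => i j; have [] := H i j.
apply: DeriveDef => //; rewrite derive_mx//; apply/matrixP => i j.
by rewrite mxE; have [_ ->] := H i j.
Qed.

Lemma is_derive_entry (V : normedModType R) m n (M : V -> 'M[R]_(m, n)) t v
    (M' : 'M[R]_(m, n)) i j :
  is_derive t v M M' -> is_derive t v (fun x => M x i j : R) (M' i j).
Proof.
move=> [dM <-]; rewrite derive_mx// mxE; apply: derivableP.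
by have /derivable_mxP := dM; exact.
Qed.

Lemma is_derive_wedge (u v : R -> 'cV[R]_2) (t : R) (u' v' : 'cV[R]_2) :
  is_derive t 1 u u' -> is_derive t 1 v v' ->
  is_derive t 1 (fun s => wedge (u s) (v s) : R)
    (wedge u' (v t) + wedge (u t) v').
Proof.
move=> du dv; have U i := is_derive_entry i 0 du; have V i := is_derive_entry i 0 dv.
rewrite (_ : (fun s => _) = (fun s => u s 0 0 : R) * (fun s => v s 1 0 : R) -
  (fun s => v s 0 0 : R) * (fun s => u s 1 0 : R)); last first.
  by apply/funext => s; rewrite wedgeE.
apply: is_derive_eq; rewrite !wedgeE /GRing.scale /=; ring.
Qed.

Lemma is_derive_outer (u v : R -> 'cV[R]_2) (t : R) (u' v' : 'cV[R]_2) :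
  is_derive t 1 u u' -> is_derive t 1 v v' ->
  is_derive t 1 (fun s => u s *m (v s)^T) (u' *m (v t)^T + u t *m v'^T).
Proof.
move=> du dv; apply: is_derive_mx => i j.
have U := is_derive_entry i 0 du; have V := is_derive_entry j 0 dv.
rewrite (_ : (fun s => _) =
  (fun s => u s i 0 : R) * (fun s => v s j 0 : R)); last first.
  by apply/funext => s; rewrite outerE.
apply: is_derive_eq; rewrite !mxE !big_ord1 !mxE /GRing.scale /=; ring.
Qed.

Lemma is_deriveZf m n (f : R -> R) (M : R -> 'M[R]_(m, n)) (t : R) (f' : R)
    (M' : 'M[R]_(m, n)) :
  is_derive t 1 f f' -> is_derive t 1 M M' ->
  is_derive t 1 (fun s => f s *: M s) (f' *: M t + f t *: M').
Proof.
move=> df dM; apply: is_derive_mx => i j; have D := is_derive_entry i j dM.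
rewrite (_ : (fun s => _) = f * (fun s => M s i j : R)); last first.
  by apply/funext => s; rewrite mxE.
apply: is_derive_eq; rewrite !mxE /GRing.scale /=; ring.
Qed.

Lemma is_derive_cV_comp (u : R -> 'cV[R]_2) (phi : R -> R) (t : R)
    (u' : 'cV[R]_2) (l : R) :
  is_derive (phi t) 1 u u' -> is_derive t 1 phi l ->
  is_derive t 1 (u \o phi) (l *: u').
Proof.
move=> du dphi; apply: is_derive_mx => i j; have U := is_derive_entry i j du.
rewrite (_ : (fun s => _) = (fun s => u s i j : R) \o phi); last by apply/funext.
by apply: is_derive_eq; rewrite !mxE mulrC.
Qed.

(** The determinant is quadratic: its differential at [A] is its polar form. *)
Lemma is_derive_det (A Z : 'M[R]_2) :
  is_derive A Z (fun B : 'M[R]_2 => \det B : R) (det_polar A Z).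
Proof.
have D i j := is_derive_entry i j (is_derive_id A Z).
rewrite (_ : (fun B => _) = (fun B : 'M[R]_2 => B 0 0 : R) * (fun B => B 1 1) -
  (fun B => B 0 1) * (fun B => B 1 0)); last first.
  by apply/funext => s; rewrite det_mx22.
by apply: is_derive_eq; rewrite /det_polar /GRing.scale /=; ring.
Qed.

Lemma is_derive_uniq (V W : normedModType R) (f : V -> W) t v a b :
  is_derive t v f a -> is_derive t v f b -> a = b.
Proof. by move=> [_ <-] [_ <-]. Qed.

Lemma is_derive1_derive1 (V : normedModType R) (f : R -> V) (t : R) a :
  is_derive t 1 f a -> derive1 f t = a.
Proof. by rewrite derive1E => -[_ ->]. Qed.

Lemma derivable_is_derive1 (V : normedModType R) (f : R -> V) (t : R) :
  derivable f t 1 -> is_derive t 1 f (derive1 f t).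
Proof. by rewrite derive1E; exact: derivableP. Qed.

Lemma near_eq_derive1 (V : normedModType R) (f g : R -> V) (I : set R) (t : R) a :
  open I -> I t -> (forall s, I s -> f s = g s) ->
  is_derive t 1 g a -> is_derive t 1 f a.
Proof.
move=> oI It e; apply: near_eq_is_derive; near=> s; apply/esym/e; near: s.
exact: open_nbhs_nbhs.
Unshelve. all: by end_near. Qed.

Lemma smooth_is_derive (V : normedModType R) (I : set R) (f : R -> V) (t : R) k :
  smooth I f -> I t -> (k < 3)%N ->
  is_derive t 1 (derive1n k f) (derive1n k.+1 f t).
Proof.
move=> [H _] It lk; rewrite derive1nS; apply: derivable_is_derive1; exact: H.
Qed.

(** If [h \o phi] is differentiable, [phi] is continuous and [h] has a nonzero
    derivative, then [phi] is differentiable: its slope function is the quotient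
    of those of [h \o phi] and [h], the latter composed with [phi]. *)
Lemma is_derive_lift (phi h f : R -> R) (t a b : R) :
  {for t, continuous phi} -> is_derive (phi t) 1 h a -> a != 0 ->
  is_derive t 1 f b -> (\forall s \near t, f s = h (phi s)) ->
  is_derive t 1 phi (b / a).
Proof.
move=> cphi /is_derive1_caratheodory[H [hE cH Ha]] a0.
move=> /is_derive1_caratheodory[F [fE cF Fb]] e.
have cHphi : {for t, continuous (H \o phi)} by apply: continuous_comp.
apply: (@near_eq_is_derive _ _ _ (fun s => phi t + F s / H (phi s) * (s - t))).
  have nH : \forall s \near t, H (phi s) != 0.
    by apply: (cHphi [set x | x != 0]); apply: open_nbhs_nbhs; split;
      [exact: open_neq | rewrite /= Ha].
  near=> s.
  have Hs : H (phi s) != 0 by near: s.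
  have es : f s = h (phi s) by near: s.
  have et : f t = h (phi t) by exact: nbhs_singleton e.
  by rewrite mulrAC -fE es et hE mulrC mulrA mulVf// mul1r addrC subrK.
apply/is_derive1_caratheodory; exists (fun s => F s / H (phi s)); split.
- by move=> z; rewrite subrr mulr0 addr0 addrC addKr.
- by apply: continuousM => //; apply: continuousV => //; rewrite /= Ha.
- by rewrite Fb Ha.
Unshelve. all: by end_near. Qed.

End Calculus.

(** * The Levi-Civita connection *)

Section LeviCivita.
Context {R : realType}.
Implicit Types (A X Y Z V : 'M[R]_2).

Lemma det_polarC X Y : det_polar X Y = det_polar Y X.
Proof. by rewrite /det_polar; ring. Qed.

Lemma det_polar_diag X : det_polar X X = 2 * \det X.
Proof. by rewrite det_mx22 /det_polar; ring. Qed.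

Lemma is_derive_lorentz_metric A X Y Z : \det A != 0 ->
  is_derive A Z ((fun B => lorentz_metric B X Y) : 'M[R]_2 -> R^o)
    (2^-1 * det_polar X Y * det_polar A Z / \det A ^+ 2).
Proof.
move=> d0; have D := is_derive_det A Z.
have DV : is_derive A Z (fun B : 'M[R]_2 => (\det B)^-1 : R)
    (- (\det A) ^- 2 * det_polar A Z).
  constructor; first by apply: derivableV => //; case: D.
  by rewrite deriveV //; case: D => _ ->.
rewrite (_ : (fun B => _) =
  (- (2^-1 * det_polar X Y)) *: (fun B : 'M[R]_2 => (\det B)^-1 : R)); last first.
  by apply/funext => B; rewrite lorentz_metricE.
apply: is_derive_eq; rewrite /GRing.scale /=; ring.
Qed.

(** The Christoffel symbols of the metric, which is the multiple
    [- (2 \det A)^-1] of the constant metric [det_polar], hence conformally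
    flat. *)
Definition christoffel A X Y : 'M[R]_2 :=
  - (2 * \det A)^-1 *:
    (det_polar A X *: Y + det_polar A Y *: X - det_polar X Y *: A).

(** Compatibility with the metric amounts to
    [det_polar (christoffel A Z X) Y + det_polar X (christoffel A Z Y) =
     - (det_polar A Z / \det A) * det_polar X Y],
    where the terms that involve [det_polar A X] and [det_polar A Y] cancel. *)
Lemma christoffel_levi_civita : is_levi_civita christoffel.
Proof.
move=> A pA; have /lt0r_neq0 d0 := sym_pos_det_gt0 pA; case: pA => sA _.
split.
- move=> X Y sX sY; apply/matrixP => i j; rewrite /christoffel !mxE.
  have symE M : sym M -> M j i = M i j by move=> sM; rewrite -[in LHS]sM mxE.
  by rewrite !symE.
- move=> a X Y Z _ _ _; apply/matrixP => i j.
  by rewrite /christoffel /det_polar !mxE; ring.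
- by move=> X Y _ _; rewrite /christoffel (det_polarC X Y) [_ *: Y + _]addrC.
- move=> X Y Z sX sY sZ.
  apply: (is_derive_eq (is_derive_lorentz_metric X Y Z d0)).
  rewrite !lorentz_metricE [det_polar (christoffel _ _ _) _]/det_polar.
  rewrite [det_polar _ (christoffel _ _ _)]/det_polar !mxE.
  by rewrite /det_polar; field.
Qed.

Lemma levi_civitaP : is_levi_civita (@levi_civita R).
Proof. by apply: getPex; exists christoffel; exact: christoffel_levi_civita. Qed.

(** For a null vector, metric compatibility along [V] and along an arbitrary
    [Z], combined with the symmetry of the connection as in Koszul's formula,
    determines [levi_civita A V V]. *)
Lemma levi_civita_null A V : sym_pos A -> sym V -> \det V = 0 ->
  levi_civita A V V = - (det_polar A V / \det A) *: V.
Proof.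
move=> pA sV V0; have /lt0r_neq0 d0 := sym_pos_det_gt0 pA.
have [symG _ GC GD] := levi_civitaP pA.
apply: det_polar_inj; first exact: symG.
  by rewrite /sym linearZ /= sV.
move=> Z sZ.
have := is_derive_uniq (GD _ _ _ sV sZ sV) (is_derive_lorentz_metric V Z V d0).
have := is_derive_uniq (GD _ _ _ sV sV sZ) (is_derive_lorentz_metric V V Z d0).
rewrite det_polar_diag V0 mulr0.
rewrite !lorentz_metricE (GC Z V)// [det_polar (levi_civita A V Z) _]det_polarC.
rewrite mulr0 !mul0r => e1.
have -> : det_polar V (levi_civita A V Z) = 0.
  move: e1 => /eqP; rewrite -mulrDl mulf_eq0 invr_eq0 (negbTE d0) orbF => /eqP.
  lra.
rewrite mulr0 oppr0 mul0r addr0 => e2.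
have -> : det_polar (- (det_polar A V / \det A) *: V) Z =
    - (det_polar A V / \det A) * det_polar V Z.
  by rewrite /det_polar !mxE; ring.
have -> : det_polar (levi_civita A V V) Z =
    - 2 * \det A * (- (2^-1 * det_polar (levi_civita A V V) Z) / \det A).
  by field.
by rewrite e2; field.
Qed.

(** The direction of time of a multiple of a square [v *m v^T] is its sign. *)
Lemma future_directed_outer A (v : 'cV[R]_2) (k : R) : v != 0 ->
  (exists g, 0 < \det g /\ A = g *m g^T) ->
  future_directed A (k *: (v *m v^T)) <-> 0 < k.
Proof.
move=> v0 [g [dg Ag]].
have E (h : 'M[R]_2) : invmx h *m (k *: (v *m v^T)) *m (invmx h)^T =
    k *: ((invmx h *m v) *m (invmx h *m v)^T).
  by rewrite -scalemxAr -scalemxAl trmx_mul !mulmxA.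
have pos (x : R) : 0 < k * (x * x) -> 0 < k.
  by rewrite -expr2 => kx; rewrite ltNge; apply: contraL kx => k0;
    rewrite -leNgt mulr_le0_ge0 ?sqr_ge0.
split=> [[h [dh _]]|k0].
  rewrite E => -[_ _]; rewrite !mxE !big_ord1 !mxE.
  by case; exact: pos.
exists g; split=> //; rewrite E; set w := _ *m v; split.
- by rewrite /sym linearZ /= trmx_mul trmxK.
- rewrite lorentz_formE det1 divr1 detZ det_mx22 !outerE.
  rewrite (_ : _ - _ = 0); last by ring.
  by rewrite mulr0 oppr0.
- have w0 : w != 0.
    apply: contra_neq v0 => e; have gu : g \in unitmx.
      by rewrite unitmxE unitfE gt_eqF.
    by rewrite -(mulKVmx gu v) -/w e mulmx0.
  move: (w) w0 => {v0 E}w w0; rewrite !mxE !big_ord1 !mxE -!expr2 !(pmulr_rgt0 _ k0).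
  rewrite !lt0r !sqr_ge0 !andbT !sqrf_eq0.
  have [e0|] := eqVneq (w 0 0) 0; last by left.
  have [e1|] := eqVneq (w 1 0) 0; last by right.
  by case/eqP: w0; apply: eq_cV2; rewrite ?e0 ?e1 mxE.
Qed.

End LeviCivita.

(** * Zero-convexity does not depend on the parametrization *)

Section Reparametrization.
Context {R : realType}.

(** Two parametrizations of a path that pass through the same point have
    positively proportional velocities there. *)
Lemma path_pos_proportional (c : oriented_path R) p v w : path_set c p ->
  path_pos c p v -> path_pos c p w -> exists2 l : R, 0 < l & v = l *: w.
Proof.
have [gamma [_ <- pos]] := oriented_pathP c; move=> [s _ <-].
rewrite pos => -[a /= a0 <-] [b /= b0 <-]; exists (a / b); first exact: divr_gt0.
by rewrite scalerA divfK ?gt_eqF.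
Qed.

(** The relation obtained by differentiating the collinearity of the velocities
    of two parametrizations, when [l] is the derivative of the change of
    parameter, [v] and [a] are the velocity and acceleration of one of them and
    [w] is the acceleration of the other. *)
Lemma wedge_reparametrize (l : R) (v a w : 'cV[R]_2) :
  wedge (l *: a) (l *: v) + wedge v w = 0 -> wedge v w = l * (l * wedge v a).
Proof.
rewrite wedgeZl wedgeZr (wedge_antisym a) => /eqP.
by rewrite addrC addr_eq0 !mulrN opprK => /eqP.
Qed.

Lemma parametrization_zero_convex (c : oriented_path R) (I : set R) alpha :
  zero_convex_path c -> parametrization c I alpha -> zero_convex_curve I alpha.
Proof.
move=> [J [beta [[[_ oJ _] [sb _ [g [gK cg]]] imb posb] zb]]].
move=> [[_ oI _] [sa _ _] ima posa].
(* the change of parameter, [alpha = beta \o phi] on [I] *)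
pose phi := g \o alpha.
have phiP s : I s -> [/\ J (phi s), beta (phi s) = alpha s &
    exists2 l : R, 0 < l & derive1 alpha s = l *: derive1 beta (phi s)].
  move=> Is; have cs : path_set c (alpha s) by rewrite -ima; exists s.
  have [r Jr rE] : (beta @` J) (alpha s) by rewrite imb.
  have -> : phi s = r by rewrite /phi /= -rE gK.
  split=> //; apply: (path_pos_proportional cs); first exact: posa.
  by rewrite -rE; exact: posb.
have da s : I s -> is_derive s 1 alpha (derive1 alpha s).
  by move=> Is; exact: (smooth_is_derive (k := 0) sa).
have dda s : I s -> is_derive s 1 (derive1 alpha) (derive1n 2 alpha s).
  by move=> Is; exact: (smooth_is_derive (k := 1) sa).
have db s : J s -> is_derive s 1 beta (derive1 beta s).
  by move=> Js; exact: (smooth_is_derive (k := 0) sb).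
have ddb s : J s -> is_derive s 1 (derive1 beta) (derive1n 2 beta s).
  by move=> Js; exact: (smooth_is_derive (k := 1) sb).
have nI s : I s -> \forall r \near s, I r by move=> Is; exact: open_nbhs_nbhs.
have cphi s : I s -> {for s, continuous phi}.
  move=> Is; have ca : {for s, continuous alpha}.
    by apply/differentiable_continuous/derivable1_diffP; case: (da s Is).
  have := (subspace_continuousP _ _).1 cg (alpha s).
  move=> /(_ _)/wrap[|cgs]; first by rewrite imb -ima; exists s.
  apply: (cvg_trans _ cgs) => S /= /ca nS.
  have {}nS : \forall r \near s, (beta @` J) (alpha r) -> S (g (alpha r)).
    exact: nS.
  suff : \forall r \near s, S (phi r) by [].
  near=> r; apply: (near nS r) => //; rewrite imb -ima; exists r => //.
  exact: (near (nI s Is) r).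
clearbody phi => t It; have [Jt bt [l l0 al]] := phiP t It.
have [w1 w2] := zb _ Jt.
have b1 : 0 < wedge (alpha t) (derive1 beta (phi t)) by rewrite -bt; exact: w1.
split; first by rewrite al wedgeZr; exact: mulr_gt0 l0 b1.
(* the derivative of [phi] is read on the functional [wedge (alpha t)] *)
have dphi : is_derive t 1 phi l.
  have dw u (x : R -> 'cV[R]_2) (s : R) x' : is_derive s 1 x x' ->
      is_derive s 1 (fun r => wedge u (x r) : R) (wedge u x').
    move=> dx; apply: (is_derive_eq (is_derive_wedge (is_derive_cst u s 1) dx)).
    by rewrite wedgeE !mxE !(mul0r, mulr0) subrr add0r.
  have b0 := lt0r_neq0 b1.
  rewrite -(mulfK b0 l) -wedgeZr -al.
  apply: (is_derive_lift (cphi t It) (dw (alpha t) _ _ _ (db _ Jt)) b0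
    (dw (alpha t) _ _ _ (da _ It))).
  by near=> s; have [|_ -> _] := phiP s; first exact: (near (nI t It) s).
have d0 : is_derive t 1
    (fun s => wedge (derive1 beta (phi s)) (derive1 alpha s) : R) 0.
  apply: (near_eq_derive1 oI It (g := cst 0)).
  by move=> s Is; have [_ _ [k _ ->]] := phiP s Is; rewrite wedgeZr wedgevv mulr0.
have := is_derive_uniq d0
  (is_derive_wedge (is_derive_cV_comp (ddb _ Jt) dphi) (dda _ It)).
rewrite al => /esym/wedge_reparametrize e.
rewrite wedgeZl [X in _ * X]e; exact: mulr_gt0 l0 (mulr_gt0 l0 (mulr_gt0 l0 w2)).
Unshelve. all: by end_near.
Qed.

End Reparametrization.

(** * The osculating ellipse *)

Section OsculatingEllipse.
Context {R : realType}.
Implicit Types (u v w a : 'cV[R]_2).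

(** The matrix of the ellipse centered at the origin that osculates at [u] a
    curve with position [u], velocity [v] and acceleration [a]. *)
Definition osculating_mx u v a : 'M[R]_2 :=
  u *m u^T + (wedge u v / wedge v a) *: (v *m v^T).

(** A harmonic parametrization of the ellipse with conjugate radii [u], [w]. *)
Definition harmonic u w (s : R) : 'cV[R]_2 := cos s *: u + sin s *: w.

Lemma enormZ (k : R) v : 0 <= k -> enorm (k *: v) = k * enorm v.
Proof.
move=> k0; rewrite /enorm (_ : dot _ _ = k ^+ 2 * dot v v).
  by rewrite sqrtrM ?sqr_ge0// sqrtr_sqr ger0_norm.
by rewrite !dotE !mxE; ring.
Qed.

Lemma enorm_gt0 v : v != 0 -> 0 < enorm v.
Proof. by move=> v0; rewrite sqrtr_gt0 dot_gt0. Qed.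

Lemma is_derive_harmonic u w (s : R) :
  is_derive s 1 (harmonic u w) (harmonic w (- u) s).
Proof.
apply: (is_derive_eq (is_deriveD
  (is_deriveZf (is_derive_cos s) (is_derive_cst u s 1))
  (is_deriveZf (is_derive_sin s) (is_derive_cst w s 1)))).
rewrite /harmonic; apply: eq_cV2; rewrite !mxE; ring.
Qed.

Lemma derive1_harmonic u w : derive1 (harmonic u w) = harmonic w (- u).
Proof.
by apply/funext => s; apply: is_derive1_derive1; exact: is_derive_harmonic.
Qed.

Lemma harmonic_smooth u w : smooth setT (harmonic u w).
Proof.
have D k u' w' s : derivable (derive1n k (harmonic u' w')) s 1.
  elim: k u' w' => [|k IH] u' w'.
    by case: (is_derive_harmonic u' w' s).
  by rewrite derive1Sn derive1_harmonic; exact: IH.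
split=> [i _ t _|t _]; first exact: D.
by apply/differentiable_continuous/derivable1_diffP; exact: D.
Qed.

Lemma range_harmonic u w : wedge u w != 0 ->
  range (harmonic u w) = ellipse (row_mx u w *m (row_mx u w)^T).
Proof.
move=> d0; rewrite ellipse_gram ?unitmxE ?unitfE//.
apply/seteqP; split=> [_ [s _ <-]|_ [p p1 <-]].
- exists (\col_i if i == 0 then cos s else sin s).
    by rewrite /= dotE !mxE /= -!expr2 cos2Dsin2.
  by apply: eq_cV2; rewrite !mulmx2E !row_mx2_0 !row_mx2_1 !mxE /=; ring.
- have [s [e0 e1]] := circle_param p1; exists s => //.
  by apply: eq_cV2; rewrite !mulmx2E !row_mx2_0 !row_mx2_1 !mxE e0 e1; ring.
Qed.

Lemma is_derive_dot (C : 'M[R]_2) (x y : R -> 'cV[R]_2) (s : R)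
    (x' y' : 'cV[R]_2) :
  is_derive s 1 x x' -> is_derive s 1 y y' ->
  is_derive s 1 (fun r => dot (C *m x r) (y r) : R)
    (dot (C *m x') (y s) + dot (C *m x s) y').
Proof.
move=> dx dy.
have X i := is_derive_entry i 0 dx; have Y i := is_derive_entry i 0 dy.
rewrite (_ : (fun r => _) =
   (C 0 0 *: (fun r => x r 0 0 : R) + C 0 1 *: (fun r => x r 1 0 : R)) *
     (fun r => y r 0 0 : R) +
   (C 1 0 *: (fun r => x r 0 0 : R) + C 1 1 *: (fun r => x r 1 0 : R)) *
     (fun r => y r 1 0 : R)); last first.
  by apply/funext => r; rewrite dotE !mulmx2E.
apply: (is_derive_eq (is_deriveD
  (is_deriveM (is_deriveD (is_deriveZ (C 0 0) (X 0)) (is_deriveZ (C 0 1) (X 1)))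
    (Y 0))
  (is_deriveM (is_deriveD (is_deriveZ (C 1 0) (X 0)) (is_deriveZ (C 1 1) (X 1)))
    (Y 1)))).
rewrite !dotE !mulmx2E !fctE /GRing.scale /= /GRing.scale /=; ring.
Qed.

(** A quadratic form is determined by two conjugate vectors [u], [v] and its
    values there. *)
Lemma conjugate_mx (C : 'M[R]_2) u v (q : R) : sym C -> q != 0 ->
  dot (C *m u) u = 1 -> dot (C *m u) v = 0 -> dot (C *m v) v = q ->
  C *m (u *m u^T + q^-1 *: (v *m v^T)) = 1%:M.
Proof.
move=> sC q0 uu uv vv.
have vu : dot (C *m v) u = 0 by rewrite sym_dotC.
have PQ : (row_mx u v)^T *m row_mx (C *m u) (q^-1 *: (C *m v)) = 1%:M.
  move: uu uv vu vv; rewrite !dotE => uu uv vu vv.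
  have trE i j : (row_mx u v)^T i j = row_mx u v j i by rewrite mxE.
  have scE i : (q^-1 *: (C *m v)) i 0 = q^-1 * (C *m v) i 0 by rewrite mxE.
  apply: eq_mx2; rewrite mulmx2E !trE !(row_mx2_0, row_mx2_1).
  - by rewrite [RHS]mxE /= -uu; ring.
  - rewrite !scE; transitivity (q^-1 * 0); last by rewrite mulr0 mxE.
    by rewrite -vu; ring.
  - by transitivity (0 : R); [rewrite -uv; ring|rewrite mxE].
  - rewrite !scE; transitivity (q^-1 * q); last by rewrite mulVf// mxE.
    by rewrite -[X in _ = _ * X]vv; ring.
rewrite -(mulmx1C PQ) tr_row_mx mul_row_col mulmxDr.
by rewrite -scalemxAr -scalemxAl !mulmxA.
Qed.

(** The component of [w] along [u] is read with either the quadratic form or the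
    determinant. *)
Lemma wedge_conjugate (C : 'M[R]_2) u v w : wedge u v != 0 ->
  dot (C *m u) u = 1 -> dot (C *m u) v = 0 ->
  wedge v w = - dot (C *m u) w * wedge u v.
Proof.
move=> uv0 uu uv; have e : dot (C *m u) w = wedge w v / wedge u v.
  rewrite [X in dot _ X](wedge_decomp w uv0) dotDr !dotZr uu uv.
  by rewrite mulr0 addr0 mulr1.
by rewrite e mulNr divfK// wedge_antisym.
Qed.

(** The ellipse with conjugate radii [u] and [m *: v] has at [u] the Euclidean
    curvature of a curve with velocity [v] and acceleration [a]; here [p] is
    [wedge u v], [q] is [wedge v a], and [n] is the length of [v]. *)
Lemma curvature_radius (m p q n : R) : m != 0 -> p != 0 -> q != 0 -> n != 0 ->
  m ^+ 2 = p / q -> m * p / (m * n) ^+ 3 = q / n ^+ 3.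
Proof.
move=> m0 p0 q0 n0 m2; rewrite exprMn exprS m2; field.
exact/and4P.
Qed.

(** The value [x] of a quadratic form at [v], recovered from the curvature of
    its unit level curve at a point [u] where the velocity is [k *: v]; here
    [p] is [wedge u v], [n] is the length of [v], [q / n ^+ 3] is the prescribed
    curvature, and [y] is the value of the polar form at [u] and the
    acceleration. *)
Lemma curvature_conjugate (k p q n x y : R) :
  k != 0 -> p != 0 -> n != 0 -> k * (k * x) + y = 0 ->
  k * (- y * p) / (k * n) ^+ 3 = q / n ^+ 3 -> x = q / p.
Proof.
move=> k0 p0 n0 /eqP; rewrite addrC addr_eq0 => /eqP ->.
rewrite opprK exprMn => e; apply: (mulIf p0); rewrite divfK//.
have := congr1 ( *%R^~ (n ^+ 3)) e; rewrite /= [RHS]divfK ?expf_neq0// => <-.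
by field; rewrite n0 k0.
Qed.

(** In this section the curve is only assumed to be zero-convex at [t]. *)
Section Osculation.
Variables (alpha : R -> 'cV[R]_2) (t : R).
Let u := alpha t.
Let v := derive1 alpha t.
Let a := derive1n 2 alpha t.
Hypotheses (uv0 : 0 < wedge u v) (va0 : 0 < wedge v a).

Let uvn0 := lt0r_neq0 uv0.
Let van0 := lt0r_neq0 va0.

(* the ratio that makes [u] and [m *: v] conjugate radii of the ellipse *)
Let m := Num.sqrt (wedge u v / wedge v a).

Let m2 : m ^+ 2 = wedge u v / wedge v a.
Proof. exact: sqr_sqrtr (ltW (divr_gt0 uv0 va0)). Qed.

Let m0 : 0 < m.
Proof. by rewrite sqrtr_gt0; exact: divr_gt0 uv0 va0. Qed.

Lemma osculating_mx_gram :
  osculating_mx u v a = row_mx u (m *: v) *m (row_mx u (m *: v))^T.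
Proof.
rewrite tr_row_mx mul_row_col /osculating_mx -m2 expr2 linearZ /=.
by rewrite -scalemxAr -scalemxAl scalerA.
Qed.

Lemma sym_pos_osculating_mx : sym_pos (osculating_mx u v a).
Proof.
rewrite osculating_mx_gram; apply: sym_pos_gram.
rewrite unitmxE unitfE -/(wedge _ _) wedgeZr.
exact: lt0r_neq0 (mulr_gt0 m0 uv0).
Qed.

Lemma osculates_osculating_mx : osculates alpha t (ellipse (osculating_mx u v a)).
Proof.
split.
  by exists (osculating_mx u v a); split => //; exact: sym_pos_osculating_mx.
have h0 x y : harmonic x y 0 = x.
  by rewrite /harmonic cos0 sin0 scale1r scale0r addr0.
exists (harmonic u (m *: v)); split; last 2 first.
- by exists m; rewrite derive1_harmonic h0.
- rewrite /euclidean_curvature derive1nS !derive1n1 !derive1_harmonic !h0.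
  rewrite -/v -/a (enormZ _ (ltW m0)) wedgeZl wedge_rot.
  have nv := lt0r_neq0 (enorm_gt0 (wedge_neq0r uvn0)).
  exact: curvature_radius (lt0r_neq0 m0) uvn0 van0 nv m2.
- split; first exact: harmonic_smooth.
  + rewrite range_harmonic ?osculating_mx_gram// wedgeZr.
    exact: lt0r_neq0 (mulr_gt0 m0 uv0).
  + move=> s; rewrite derive1_harmonic.
    rewrite (_ : wedge _ _ = (cos s ^+ 2 + sin s ^+ 2) * (m * wedge u v)).
      by rewrite cos2Dsin2 mul1r; exact: mulr_gt0 m0 uv0.
    by rewrite !wedgeE !mxE; ring.
- exact: h0.
Qed.

(** Differentiating the equation of the ellipse twice along [eps] makes [u] and
    [v] conjugate and relates the value of the form at [v] to the curvature. *)
Lemma osculates_unique (B : 'M[R]_2) :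
  sym_pos B -> osculates alpha t (ellipse B) -> B = osculating_mx u v a.
Proof.
move=> pB [_ [eps [[seps reps ceps] eps0 [k ek] curv]]].
have sB : sym B by case: pB.
have uB : B \in unitmx.
  by rewrite unitmxE unitfE; exact: lt0r_neq0 (sym_pos_det_gt0 pB).
have sC : sym (invmx B) by rewrite /sym trmx_inv sB.
have de (s : R) : is_derive s 1 eps (derive1 eps s).
  exact: (smooth_is_derive (k := 0) seps).
have dde (s : R) : is_derive s 1 (derive1 eps) (derive1n 2 eps s).
  exact: (smooth_is_derive (k := 1) seps).
have q0 s : dot (invmx B *m eps s) (eps s) = 1.
  have : range eps (eps s) by exists s.
  by rewrite reps.
have q1 s : dot (invmx B *m eps s) (derive1 eps s) = 0.
  have d : is_derive s 1 (fun r => dot (invmx B *m eps r) (eps r) : R) 0.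
    rewrite (_ : (fun r => _) = cst 1); last by apply/funext => r; rewrite q0.
    exact: is_derive_cst.
  have := is_derive_uniq (is_derive_dot (invmx B) (de s) (de s)) d.
  rewrite (sym_dotC (derive1 eps s) _ sC) -mulr2n => /eqP.
  by rewrite mulrn_eq0 /= => /eqP.
have q2 : dot (invmx B *m derive1 eps 0) (derive1 eps 0) +
    dot (invmx B *m eps 0) (derive1n 2 eps 0) = 0.
  have d : is_derive (0 : R) 1
      (fun r => dot (invmx B *m eps r) (derive1 eps r) : R) 0.
    rewrite (_ : (fun r => _) = cst 0); last by apply/funext => r; rewrite q1.
    exact: is_derive_cst.
  exact: is_derive_uniq (is_derive_dot (invmx B) (de 0) (dde 0)) d.
have k0 : 0 < k.
  by have := ceps 0; rewrite eps0 ek wedgeZr (pmulr_lgt0 _ uv0).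
move: curv q2 (q0 0) (q1 0); rewrite /euclidean_curvature eps0 ek -/u -/v -/a.
move: (derive1n 2 eps 0) => e2 curv.
rewrite !dotZr -scalemxAr dotZl => q2 uu /eqP.
rewrite mulf_eq0 (negbTE (lt0r_neq0 k0)) /= => /eqP uv.
have nv := lt0r_neq0 (enorm_gt0 (wedge_neq0r uvn0)).
have vv : dot (invmx B *m v) v = wedge v a / wedge u v.
  move: curv; rewrite (enormZ _ (ltW k0)) wedgeZl (wedge_conjugate e2 uvn0 uu uv).
  exact: curvature_conjugate (lt0r_neq0 k0) uvn0 nv q2.
rewrite -[RHS](mulKVmx uB) /osculating_mx -[_ / _]invrK invf_div.
have va_uv0 := mulf_neq0 van0 (invr_neq0 uvn0).
by rewrite (conjugate_mx sC va_uv0 uu uv vv) mulmx1.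
Qed.

End Osculation.
End OsculatingEllipse.

(** * The curve of osculating ellipses *)

Section CurveOfEllipses.
Context {R : realType}.
Implicit Types (u v a : 'cV[R]_2).

Lemma det_outer (k : R) v : \det (k *: (v *m v^T)) = 0.
Proof. by rewrite detZ det_mx22 !outerE; ring. Qed.

Lemma gramE u v : row_mx u v *m (row_mx u v)^T = u *m u^T + v *m v^T.
Proof. by rewrite tr_row_mx mul_row_col. Qed.

Lemma det_gram u v : \det (u *m u^T + v *m v^T) = wedge u v ^+ 2.
Proof. by rewrite -gramE det_mulmx det_tr expr2. Qed.

(** The osculating ellipse, and its matrix in the chart [ellipse_mx]. *)
Lemma osculating_ellipseP (alpha : R -> 'cV[R]_2) t :
  0 < wedge (alpha t) (derive1 alpha t) ->
  0 < wedge (derive1 alpha t) (derive1n 2 alpha t) ->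
  is_ellipse (osculating_ellipse alpha t) /\
  ellipse_mx (osculating_ellipse alpha t) =
    osculating_mx (alpha t) (derive1 alpha t) (derive1n 2 alpha t).
Proof.
move=> uv va.
have oE : osculates alpha t (osculating_ellipse alpha t).
  by apply: (@getPex _ (osculates alpha t)); exists
    (ellipse (osculating_mx (alpha t) (derive1 alpha t) (derive1n 2 alpha t)));
    exact: osculates_osculating_mx uv va.
have iE := oE.1; split; first exact: iE.
have [pA EA] := getPex iE; apply: osculates_unique uv va _ pA _.
by rewrite -[X in osculates _ _ X]EA; exact: oE.
Qed.

(** The derivative of [osculating_mx] is proportional to [v *m v^T].  For
    [m = wedge u v / wedge v a] the hypothesis on [a] is Cramer's rule, and the
    component of [a] along [u] cancels the first two terms. *)
Lemma osculating_mx_velocity u v a (m m' y : R) :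
  m *: a = - u + (m * y) *: v ->
  v *m u^T + u *m v^T + (m' *: (v *m v^T) + m *: (a *m v^T + v *m a^T)) =
  (m' + 2 * m * y) *: (v *m v^T).
Proof.
move=> /matrixP e; apply/matrixP => i j.
have /= := e i 0; have /= := e j 0; rewrite !mxE !big_ord1 !mxE => ej ei.
rewrite mulrDr [m * (a i ord0 * _)]mulrA ei [m * (v i ord0 * _)]mulrCA ej; ring.
Qed.

Lemma is_derive_osculating_mx (u v a : R -> 'cV[R]_2) (t : R) b :
  is_derive t 1 u (v t) -> is_derive t 1 v (a t) -> is_derive t 1 a b ->
  wedge (u t) (v t) != 0 -> wedge (v t) (a t) != 0 ->
  exists mu : R, is_derive t 1 (fun s => osculating_mx (u s) (v s) (a s))
    (mu *: (v t *m (v t)^T)).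
Proof.
move=> du dv da p0 q0.
have [m' dm] : exists m', is_derive t 1
    (fun s => wedge (u s) (v s) / wedge (v s) (a s) : R) m'.
  eexists; apply: (is_deriveM (is_derive_wedge du dv)
    (is_deriveV q0 (is_derive_wedge dv da))).
eexists; apply: (is_derive_eq (is_deriveD (is_derive_outer du du)
  (is_deriveZf dm (is_derive_outer dv dv)))).
apply: (@osculating_mx_velocity _ _ _ _ _ (wedge (u t) (a t) / wedge (u t) (v t))).
rewrite [X in _ *: X](wedge_decomp (a t) p0) (wedge_antisym (a t)).
move: p0 q0; move: (wedge _ _) (wedge _ _) (wedge _ _) => p q r p0 q0.
by apply: eq_cV2; rewrite !mxE; field; rewrite p0 q0.
Qed.

(** In a standard centro-affine parametrization with curvature [k], the matrix of
    the osculating ellipse is the Gram matrix differentiated here. *)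
Lemma is_derive_gram (u v : R -> 'cV[R]_2) (t k : R) a :
  is_derive t 1 u (v t) -> is_derive t 1 v a ->
  a = - u t + (2^-1 * k) *: v t ->
  is_derive t 1 (fun s => u s *m (u s)^T + v s *m (v s)^T)
    (k *: (v t *m (v t)^T)).
Proof.
move=> du dv e; apply: (is_derive_eq (is_deriveD (is_derive_outer du du)
  (is_derive_outer dv dv))).
by rewrite e; apply/matrixP => i j; rewrite !mxE !big_ord1 !mxE; field.
Qed.

(** The covariant acceleration of the curve of ellipses: the connection term
    removes the component of the second derivative along [v *m v^T] that is
    quadratic in [k], and the remaining one, [k'], does not affect the form. *)
Lemma lorentz_form_acceleration u v a (k k' : R) (A := u *m u^T + v *m v^T) :
  wedge u v != 0 -> a = - u + (2^-1 * k) *: v ->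
  lorentz_form A (k' *: (v *m v^T) + k *: (a *m v^T + v *m a^T) +
    - (det_polar A (k *: (v *m v^T)) / \det A) *: (k *: (v *m v^T))) = k ^+ 2.
Proof.
move=> p0 ->; have -> : det_polar A (k *: (v *m v^T)) = k * wedge u v ^+ 2.
  by rewrite /A /det_polar !mxE !big_ord1 !mxE wedgeE; ring.
rewrite lorentz_formE /A det_gram mulfK ?expf_neq0//.
rewrite (_ : \det _ = - k ^+ 2 * wedge u v ^+ 2).
  by rewrite mulfK ?expf_neq0// opprK.
by rewrite det_mx22 wedgeE !mxE !big_ord1 !mxE; field.
Qed.

End CurveOfEllipses.

Theorem theorem3 (R : realType) (c : oriented_path R) (I : set R)
    (alpha : R -> 'cV[R]_2)
    (hc : zero_convex_path c) (halpha : parametrization c I alpha) :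
  let E : R -> set 'cV[R]_2 := osculating_ellipse alpha in
  let A : R -> 'M[R]_2 := fun t => ellipse_mx (E t) in
  (forall t, I t ->
     [/\ is_ellipse (E t), derivable A t 1 & lorentz_form (A t) (derive1 A t) = 0])
  /\
  (forall kappa : R -> R, centro_affine_curvature I alpha kappa ->
   forall t, I t ->
     [/\ derivable (derive1 A) t 1,
         kappa t ^+ 2 = lorentz_form (A t) (covariant_derivative A (derive1 A) t),
         0 < kappa t <-> future_directed (A t) (derive1 A t) &
         kappa t < 0 <-> past_directed (A t) (derive1 A t)]).
Proof.
move=> E A; have zc := parametrization_zero_convex hc halpha.
have [[_ oI _] [sa _ _] _ _] := halpha.
have d0 (s : R) : I s -> is_derive s 1 alpha (derive1 alpha s).
  by move=> Is; exact: (smooth_is_derive (k := 0) sa).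
have d1 (s : R) : I s -> is_derive s 1 (derive1 alpha) (derive1n 2 alpha s).
  by move=> Is; exact: (smooth_is_derive (k := 1) sa).
have d2 (s : R) : I s -> is_derive s 1 (derive1n 2 alpha) (derive1n 3 alpha s).
  by move=> Is; exact: (smooth_is_derive (k := 2) sa).
have AE s : I s ->
    A s = osculating_mx (alpha s) (derive1 alpha s) (derive1n 2 alpha s).
  by move=> Is; have [uv va] := zc s Is; have [_] := osculating_ellipseP uv va.
split=> [t It|kappa [sk ka] t It].
- have [uv va] := zc t It; have [iE _] := osculating_ellipseP uv va.
  have [mu dosc] := is_derive_osculating_mx (d0 t It) (d1 t It) (d2 t It)
    (lt0r_neq0 uv) (lt0r_neq0 va).
  have dA := near_eq_derive1 oI It AE dosc.
  split; [exact: iE | by case: dA |].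
  by rewrite (is_derive1_derive1 dA) lorentz_formE det_outer mul0r oppr0.
- (* in a standard centro-affine parametrization both wedges agree *)
  have AG s : I s -> A s =
      alpha s *m (alpha s)^T + derive1 alpha s *m (derive1 alpha s)^T.
    move=> Is; have [uv va] := zc s Is; rewrite (AE s Is) /osculating_mx.
    have -> : wedge (derive1 alpha s) (derive1n 2 alpha s) =
        wedge (alpha s) (derive1 alpha s).
      by rewrite (ka s Is) !wedgeE !mxE; ring.
    by rewrite (divff (lt0r_neq0 uv)) scale1r.
  have dA s : I s -> is_derive s 1 A
      (kappa s *: (derive1 alpha s *m (derive1 alpha s)^T)).
    move=> Is; apply: (near_eq_derive1 oI Is AG).
    exact: is_derive_gram (d0 s Is) (d1 s Is) (ka s Is).
  have A1 s : I s -> derive1 A s =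
      kappa s *: (derive1 alpha s *m (derive1 alpha s)^T).
    by move=> Is; exact: is_derive1_derive1 (dA s Is).
  have dk : is_derive t 1 kappa (derive1 kappa t).
    exact: (smooth_is_derive (k := 0) sk It).
  have ddA := near_eq_derive1 oI It A1
    (is_deriveZf dk (is_derive_outer (d1 t It) (d1 t It))).
  have [uv _] := zc t It; have uv0 := lt0r_neq0 uv.
  have g0 : exists g, 0 < \det g /\ A t = g *m g^T.
    by exists (row_mx (alpha t) (derive1 alpha t)); split;
      [exact: uv | rewrite gramE; exact: AG].
  have pA : sym_pos (A t).
    rewrite (AG t It) -gramE; apply: sym_pos_gram.
    by rewrite unitmxE unitfE; exact: uv0.
  have symA1 : sym (derive1 A t).
    by rewrite (A1 t It) /sym linearZ /= trmx_mul trmxK.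
  have det0 : \det (derive1 A t) = 0 by rewrite (A1 t It) det_outer.
  split.
  + by case: ddA.
  + rewrite /covariant_derivative (is_derive1_derive1 ddA).
    rewrite (levi_civita_null pA symA1 det0) (A1 t It) (AG t It).
    by rewrite (lorentz_form_acceleration _ uv0 (ka t It)).
  + rewrite (A1 t It); apply: iff_sym.
    exact: future_directed_outer (wedge_neq0r uv0) g0.
  + rewrite /past_directed (A1 t It) -scaleNr -oppr_gt0; apply: iff_sym.
    exact: future_directed_outer (wedge_neq0r uv0) g0.
Qed.
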